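(* Let $n>1$ and $\lambda\in F$ (the case $\lambda=0$ being allowed). Let $(a,b,c)$ be a triple of positive integers satisfying $$a+b=n+1,\ c\le a\quad\text{or}\quad c+b=n+1,\ a\le c,$$ let $M\in M_{a\times b}$ and $N\in M_{b\times c}$ be such that $M_{a,1}\neq 0$ and $N_{b,1}\neq 0$, and let $\alpha\in F$. Then the linear map $R_{a,b,c,M,N,\alpha}:\mathfrak g\to\mathfrak{gl}(d)$, $d=a+b+c$, is a uniserial representation of $\mathfrak g$.
   Context: $F$ is an algebraically closed field of characteristic $0$; all Lie algebras and representations are finite dimensional over $F$. $M_{p\times q}$ is the space of $p\times q$ matrices over $F$, and $\mathfrak{gl}(d)$ is the Lie algebra of $d\times d$ matrices over $F$. A representation (module) is uniserial if it has a unique composition series. The Lie algebra $\mathfrak g$. Let $V$ be an $F$-vector space of dimension $n>1$ with basis $v_0,\dots,v_{n-1}$. $L(V)=V\oplus\Lambda^2(V)$ is the free 2-step nilpotent Lie algebra: $[v,w]=v\wedge w$ and $[u,v\wedge w]=0$ for $u,v,w\in V$ (and $[\Lambda^2(V),\Lambda^2(V)]=0$). Then $\mathfrak g=\langle x\rangle\ltimes L(V)$, where $x$ acts on $V$ by $[x,v_i]=\lambda v_i+v_{i+1}$ for $0\le i\le n-2$ and $[x,v_{n-1}]=\lambda v_{n-1}$, and on $\Lambda^2(V)$ by $[x,v\wedge w]=[x,v]\wedge w+v\wedge[x,w]$. The map $R_{a,b,c,M,N,\alpha}$. $J^p(\beta)$ is the upper triangular Jordan block of size $p$ and eigenvalue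 $\beta$. The linear map $R=R_{a,b,c,M,N,\alpha}:\mathfrak g\to\mathfrak{gl}(d)$, $d=a+b+c$, is defined in block form (block sizes $a,b,c$) by $$R(x)=A=\begin{pmatrix}J^a(\alpha)&0&0\\0&J^b(\alpha-\lambda)&0\\0&0&J^c(\alpha-2\lambda)\end{pmatrix},$$ $$R(v_k)=(\mathrm{ad}_{\mathfrak{gl}(d)}A-\lambda 1_{\mathfrak{gl}(d)})^k\begin{pmatrix}0&M&0\\0&0&N\\0&0&0\end{pmatrix},\quad 0\le k\le n-1,$$ $$R(v\wedge w)=[R(v),R(w)],\quad v,w\in V.$$ *)

(* Defs.v *)
From HB Require Import structures.
From mathcomp Require Import all_boot all_order all_algebra.
From mathcomp Require Import ring.

Set Implicit Arguments.
Unset Strict Implicit.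
Unset Printing Implicit Defensive.

Import GRing.Theory.
Local Open Scope ring_scope.

HB.mixin Record Vector_isLieAlgebra (F : fieldType) L of Vector F L := {
  lie : L -> L -> L;
  lie_linearl : forall w : L, linear (fun u : L => lie u w);
  lie_linearr : forall u : L, linear (lie u);
  lie_alt : forall u : L, lie u u = 0;
  lie_jacobi : forall u v w : L,
    lie u (lie v w) + lie v (lie w u) + lie w (lie u v) = 0
}.

#[short(type="lieAlgType")]
HB.structure Definition LieAlgebra (F : fieldType) :=
  { L of Vector F L & Vector_isLieAlgebra F L }.

Notation "[lie u , v ]" := (lie u v)
  (at level 0, u at level 99, v at level 99, format "[lie  u ,  v ]").

Section GL.
Variables (F : fieldType) (d : nat).
Implicit Types X Y Z : 'M[F]_d.

Definition commutator X Y : 'M[F]_d := X *m Y - Y *m X.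

Fact commutator_linearl Y : linear (commutator^~ Y).
Proof.
move=> k X X'; rewrite /commutator mulmxDl mulmxDr -scalemxAl -scalemxAr.
by rewrite scalerBr opprD addrACA.
Qed.

Fact commutator_linearr X : linear (commutator X).
Proof.
move=> k Y Y'; rewrite /commutator mulmxDl mulmxDr -scalemxAl -scalemxAr.
by rewrite scalerBr opprD addrACA.
Qed.

Fact commutator_alt X : commutator X X = 0.
Proof. exact: subrr. Qed.

Fact commutator_jacobi X Y Z :
  commutator X (commutator Y Z) + commutator Y (commutator Z X)
    + commutator Z (commutator X Y) = 0.
Proof.
rewrite /commutator !(mulmxBl, mulmxBr) !mulmxA !opprB.
set p1 := X *m Y *m Z; set p2 := X *m Z *m Y; set p3 := Y *m Z *m X.
set p4 := Z *m Y *m X; set p5 := Y *m X *m Z; set p6 := Z *m X *m Y.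
by apply/matrixP => i j; rewrite !mxE; ring.
Qed.

HB.instance Definition _ := Vector_isLieAlgebra.Build F 'M[F]_d
  commutator_linearl commutator_linearr commutator_alt commutator_jacobi.

End GL.

Section Modules.
Variables (F : fieldType) (L : lieAlgType F) (d : nat).
Variable rho : L -> 'M[F]_d.

Definition is_representation : Prop :=
  linear rho /\ forall u v : L, rho [lie u, v] = [lie rho u, rho v].

(* L acts on column vectors through rho. *)
Definition is_submodule (W : {vspace 'cV[F]_d}) : Prop :=
  forall (u : L) (z : 'cV[F]_d), z \in W -> rho u *m z \in W.

(* W' / W is an irreducible module, stated through the submodules of W' that
   contain W. *)
Definition irreducible_factor (W W' : {vspace 'cV[F]_d}) : Prop :=
  [/\ (W <= W')%VS, W != W' &
      forall U : {vspace 'cV[F]_d}, is_submodule U ->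
        (W <= U)%VS -> (U <= W')%VS -> U = W \/ U = W'].

(* s lists the terms of the series in increasing order, both ends included. *)
Definition composition_series (s : seq {vspace 'cV[F]_d}) : Prop :=
  let W := nth 0%VS s in
  [/\ (0 < size s)%N,
      W 0%N = 0%VS,
      W (size s).-1 = fullv,
      forall i, (i < size s)%N -> is_submodule (W i) &
      forall i, (i.+1 < size s)%N -> irreducible_factor (W i) (W i.+1)].

Definition is_uniserial_representation : Prop :=
  is_representation /\ exists! s, composition_series s.

End Modules.

Definition Jordan_block (F : fieldType) (p : nat) (beta : F) : 'M[F]_p :=
  \matrix_(i, j) (beta *+ (i == j) + ((i.+1 == j)%N)%:R).

(* V is 'rV[F]_n with v_i the i-th unit row vector, and Lambda^2(V) is the space
   of skew-symmetric n x n matrices, v /\ w being v^T w - w^T v.  This is a model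
   of the exterior square as soon as 2 != 0 in F (see Lambda2_universal). *)
Section Lambda2.
Variables (F : fieldType) (n : nat).
Local Notation V := 'rV[F]_n.

Definition symmetrize (S : 'M[F]_n) : 'M[F]_n := S + S^T.

Fact symmetrize_linear : linear symmetrize.
Proof. by move=> k S T; rewrite /symmetrize linearP /= scalerDr addrACA. Qed.

HB.instance Definition _ :=
  GRing.isLinear.Build F 'M[F]_n 'M[F]_n *:%R symmetrize symmetrize_linear.

Definition skew : {vspace 'M[F]_n} := lker (linfun symmetrize).

Lemma skewP (S : 'M[F]_n) : reflect (S^T = - S) (S \in skew).
Proof.
rewrite memv_ker lfunE /= /symmetrize addrC addr_eq0.
exact: eqP.
Qed.

Definition Lambda2 := subvs_of skew.
HB.instance Definition _ := Vector.on Lambda2.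

Definition wedge_mx (v w : V) : 'M[F]_n := v^T *m w - w^T *m v.

Fact wedge_mx_skew v w : wedge_mx v w \in skew.
Proof.
by apply/skewP; rewrite /wedge_mx linearB /= !trmx_mul !trmxK opprB.
Qed.

Definition wedge (v w : V) : Lambda2 := Subvs (wedge_mx_skew v w).

Lemma wedge_linearl w : linear (wedge^~ w).
Proof.
move=> k v v'; apply: val_inj; rewrite /= /wedge_mx !linearP /=.
by rewrite mulmxDl -!scalemxAl scalerBr scalerN addrACA.
Qed.

Lemma wedge_linearr v : linear (wedge v).
Proof.
move=> k w w'; apply: val_inj; rewrite /= /wedge_mx !linearP /=.
by rewrite mulmxDl -!scalemxAl scalerBr opprD addrACA.
Qed.

HB.instance Definition _ v :=
  GRing.isLinear.Build F V Lambda2 *:%R (wedge v) (wedge_linearr v).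

Lemma wedge_alt v : wedge v v = 0.
Proof. by apply: val_inj; rewrite /= /wedge_mx subrr. Qed.

Lemma wedgeC v w : wedge w v = - wedge v w.
Proof. by apply: val_inj; rewrite /= /wedge_mx opprB. Qed.

Definition vb (i : 'I_n) : V := delta_mx 0 i.

Lemma Lambda2_decomp (S : Lambda2) : 2%:R != 0 :> F ->
  S = \sum_(i < n) \sum_(j < n | (i < j)%N) vsval S i j *: wedge (vb i) (vb j).
Proof.
move=> nz2; apply: val_inj; have /skewP/matrixP eS := subvsP S.
rewrite raddf_sum /=; apply/matrixP => k l; rewrite summxE.
under eq_bigr => i _ do rewrite raddf_sum /= summxE.
have E i j : (vsval (vsval S i j *: wedge (vb i) (vb j))) k l
    = vsval S i j * ((k == i) && (l == j))%:R - vsval S i j * ((k == j) && (l == i))%:R.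
  rewrite /= /wedge_mx /vb !trmx_delta !mul_delta_mx !mxE -mulrBr.
  by [].
under eq_bigr => i _ do under eq_bigr => j _ do rewrite E.
under eq_bigr => i _ do rewrite sumrB.
rewrite sumrB.
have pick (a b : 'I_n) : \sum_(i < n) \sum_(j < n | (i < j)%N)
    vsval S i j * ((a == i) && (b == j))%:R = if (a < b)%N then vsval S a b else 0.
  rewrite (bigD1 a) //= [X in _ + X]big1 ?addr0; last first.
    by move=> i /negPf ia; rewrite big1 // => j _; rewrite eq_sym ia mulr0.
  case: ifP => ab.
    rewrite (bigD1 b) //= !eqxx mulr1 big1 ?addr0 // => j /andP[_ /negPf jb].
    by rewrite [b == j]eq_sym jb mulr0.
  rewrite big1 // => j aj; case: (eqVneq b j) => [bj|]; last by rewrite andbF mulr0.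
  by rewrite bj aj in ab.
rewrite pick; under [X in _ - X]eq_bigr => i _ do under eq_bigr => j _ do rewrite andbC.
rewrite pick; have := eS l k; rewrite !mxE.
case: ltngtP => [kl|lk|/val_inj <-] //= => [_|->|/eqP]; rewrite ?subr0 ?sub0r //.
by rewrite -addr_eq0 -mulr2n -mulr_natl mulf_eq0 (negPf nz2) => /eqP.
Qed.

Lemma Lambda2_universal (U : lmodType F) (f : V -> V -> U) :
    2%:R != 0 :> F ->
    (forall w, linear (f^~ w)) -> (forall v, linear (f v)) ->
    (forall v, f v v = 0) ->
  let g (S : Lambda2) :=
    \sum_(i < n) \sum_(j < n | (i < j)%N) vsval S i j *: f (vb i) (vb j) in
  [/\ linear g, forall v w, g (wedge v w) = f v w &
      forall h : {linear Lambda2 -> U},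
        (forall v w, h (wedge v w) = f v w) -> h =1 g].
Proof.
move=> nz2 fl fr fa g; split; last 1 first.
- move=> h hE S; rewrite [in LHS](Lambda2_decomp S nz2) linear_sum.
  apply: eq_bigr => i _; rewrite linear_sum; apply: eq_bigr => j _.
  by rewrite linearZ /= hE.
- move=> k S T; rewrite /g scaler_sumr -big_split; apply: eq_bigr => i _ /=.
  rewrite scaler_sumr -big_split; apply: eq_bigr => j _ /=.
  by rewrite !mxE scalerDl scalerA.
move=> v w.
pose fL w := HB.pack_for {linear V -> U} (f^~ w)
  (GRing.isLinear.Build F V U *:%R (f^~ w) (fl w)).
pose fR v := HB.pack_for {linear V -> U} (f v)
  (GRing.isLinear.Build F V U *:%R (f v) (fr v)).
have fC a b : f b a = - f a b.
  apply/eqP; rewrite -addr_eq0 addrC; apply/eqP.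
  have := fa (a + b); rewrite -[LHS]/(fL (a + b) (a + b)) linearD /=.
  rewrite -[f a _]/(fR a (a + b)) -[f b _]/(fR b (a + b)) !linearD /=.
  by rewrite !fa add0r addr0.
have expand : f v w =
    \sum_(i < n) \sum_(j < n) (v 0 i * w 0 j) *: f (vb i) (vb j).
  rewrite -[LHS]/(fL w v) [in LHS](row_sum_delta v) linear_sum.
  apply: eq_bigr => i _; rewrite linearZ /=.
  rewrite -[f _ w]/(fR (vb i) w) [in LHS](row_sum_delta w) linear_sum scaler_sumr.
  by apply: eq_bigr => j _; rewrite linearZ /= scalerA.
have split3 : f v w =
    \sum_(i < n) \sum_(j < n | (i < j)%N) (v 0 i * w 0 j) *: f (vb i) (vb j)
    + \sum_(i < n) \sum_(j < n | (j < i)%N) (v 0 i * w 0 j) *: f (vb i) (vb j).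
  rewrite expand -big_split; apply: eq_bigr => i _ /=.
  rewrite (bigID (fun j : 'I_n => (i < j)%N)) /=; congr (_ + _).
  rewrite (bigID (fun j : 'I_n => (j < i)%N)) /= addrC big1 ?add0r.
    by apply: eq_bigl => j; case: ltngtP.
  move=> j; rewrite -!leqNgt => /andP[ji ij].
  have -> : i = j by apply/val_inj/eqP; rewrite eqn_leq ij ji.
  by rewrite fa scaler0.
rewrite split3 [X in _ = _ + X](exchange_big_dep xpredT) //= -big_split.
apply: eq_bigr => i _; rewrite -big_split; apply: eq_bigr => j _ /=.
rewrite [f (vb j) _]fC scalerN -scalerBl; congr (_ *: _).
rewrite /wedge_mx !mxE !big_ord1 !mxE; ring.
Qed.

(* The derivation of Lambda^2(V) induced by the endomorphism v |-> v *m D. *)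
Definition der_mx (D S : 'M[F]_n) : 'M[F]_n := D^T *m S + S *m D.

Fact der_mx_skew D (S : Lambda2) : der_mx D (vsval S) \in skew.
Proof.
have /skewP eS := subvsP S; apply/skewP.
by rewrite /der_mx linearD /= !trmx_mul trmxK eS mulmxN mulNmx opprD addrC.
Qed.

Definition der (D : 'M[F]_n) (S : Lambda2) : Lambda2 := Subvs (der_mx_skew D S).

Fact der_linear D : linear (der D).
Proof.
move=> k S T; apply: val_inj; rewrite /= /der_mx mulmxDl mulmxDr.
by rewrite -scalemxAl -scalemxAr scalerDr addrACA.
Qed.

HB.instance Definition _ D :=
  GRing.isLinear.Build F Lambda2 Lambda2 *:%R (der D) (der_linear D).

Lemma der_wedge D v w : der D (wedge v w) = wedge (v *m D) w + wedge v (w *m D).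
Proof.
apply: val_inj; rewrite /= /der_mx /wedge_mx !trmx_mul mulmxBr mulmxBl !mulmxA.
by apply/matrixP => i j; rewrite !mxE; ring.
Qed.

End Lambda2.

Fact combl (F : fieldType) (W : lmodType F) (k s s' t : F) (x y y' p p' : W) :
  (k * s + s') *: x - t *: (k *: y + y') + (k *: p + p')
    = k *: (s *: x - t *: y + p) + (s' *: x - t *: y' + p').
Proof.
rewrite scalerDl !scalerDr scalerN !scalerA [t * k]mulrC opprD.
by rewrite [X in X + _ = _]addrACA [LHS]addrACA.
Qed.

Fact combr (F : fieldType) (W : lmodType F) (k s s' t : F) (x y y' p p' : W) :
  t *: (k *: y + y') - (k * s + s') *: x + (k *: p + p')
    = k *: (t *: y - s *: x + p) + (t *: y' - s' *: x + p').
Proof.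
rewrite scalerDl !scalerDr scalerN !scalerA [t * k]mulrC opprD.
by rewrite [X in X + _ = _]addrACA [LHS]addrACA.
Qed.

(* <x> |>< L(V) as triples (t, v, S) standing for t x + v + S. *)
Definition xfree2 (F : fieldType) (n : nat) (lambda : F) : Type :=
  (F^o * 'rV[F]_n * Lambda2 F n)%type.

Section XFree2.
Variables (F : fieldType) (n : nat) (lambda : F).
Local Notation g := (xfree2 n lambda).

HB.instance Definition _ := Vector.on g.

(* Row i of D is lambda v_i + v_{i+1}, so that ad x is v |-> v *m D on V. *)
Local Notation D := (Jordan_block n lambda).

Definition crd_x (u : g) : F := u.1.1.
Definition crd_V (u : g) : 'rV[F]_n := u.1.2.
Definition crd_L (u : g) : Lambda2 F n := u.2.

Definition xfree2_lie (u w : g) : g :=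
  (0,
   crd_x u *: (crd_V w *m D) - crd_x w *: (crd_V u *m D),
   crd_x u *: der D (crd_L w) - crd_x w *: der D (crd_L u)
     + wedge (crd_V u) (crd_V w)).

Fact xfree2_lie_linearl w : linear (xfree2_lie^~ w).
Proof.
case: w => [[t z] T] k [[s v] S] [[s' v'] S']; congr (_, _, _).
- by rewrite /= scaler0 addr0.
- have := combl k s s' t (z *m D) (v *m D) (v' *m D) 0 0.
  by rewrite scaler0 !addr0 [k *: (_ *m _)]scalemxAl -mulmxDl.
- have := combl k s s' t (der D T) (der D S) (der D S') (wedge v z) (wedge v' z).
  by rewrite -!wedge_linearl -linearP.
Qed.

Fact xfree2_lie_linearr u : linear (xfree2_lie u).
Proof.
case: u => [[t z] T] k [[s v] S] [[s' v'] S']; congr (_, _, _).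
- by rewrite /= scaler0 addr0.
- have := combr k s s' t (z *m D) (v *m D) (v' *m D) 0 0.
  by rewrite scaler0 !addr0 [k *: (_ *m _)]scalemxAl -mulmxDl.
- have := combr k s s' t (der D T) (der D S) (der D S') (wedge z v) (wedge z v').
  by rewrite -!wedge_linearr -linearP.
Qed.

Fact xfree2_lie_alt u : xfree2_lie u u = 0.
Proof. by rewrite /xfree2_lie !subrr wedge_alt addr0. Qed.

Fact xfree2_lie_jacobi u v w :
  xfree2_lie u (xfree2_lie v w) + xfree2_lie v (xfree2_lie w u)
    + xfree2_lie w (xfree2_lie u v) = 0.
Proof.
case: u v w => [[r u] R] [[s v] S] [[t w] T]; congr (_, _, _).
- by rewrite /= !addr0.
- rewrite /= /xfree2_lie /crd_x /crd_V /=; move: (r : F) (s : F) (t : F) => {}r {}s {}t.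
  rewrite !(mulmxBl, scale0r, subr0) -!scalemxAl.
  by apply/matrixP => i j; rewrite !mxE; ring.
- rewrite /= /xfree2_lie /crd_x /crd_V /crd_L /=.
  move: (r : F) (s : F) (t : F) => {}r {}s {}t.
  have wedgeB (x y z : 'rV[F]_n) (k l : F) :
      wedge x (k *: y - l *: z) = k *: wedge x y - l *: wedge x z.
    by rewrite linearB !linearZ.
  have derB (P Q W : Lambda2 F n) (k l : F) :
      der D (k *: P - l *: Q + W) = k *: der D P - l *: der D Q + der D W.
    by rewrite linearD linearB !linearZ.
  rewrite !derB !der_wedge !wedgeB !scale0r !subr0.
  rewrite (wedgeC (v *m D) w) (wedgeC (w *m D) u) (wedgeC (u *m D) v).
  move: (der D (der D R)) (der D (der D S)) (der D (der D T)).
  move: (wedge (v *m D) w) (wedge (w *m D) u) (wedge (u *m D) v).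
  move: (wedge v (w *m D)) (wedge w (u *m D)) (wedge u (v *m D)).
  move=> x1 x2 x3 x4 x5 x6 x7 x8 x9.
  by apply/val_inj/matrixP => i j; rewrite !mxE; ring.
Qed.

HB.instance Definition _ := Vector_isLieAlgebra.Build F g
  xfree2_lie_linearl xfree2_lie_linearr xfree2_lie_alt xfree2_lie_jacobi.

Definition gx : g := (1, 0, 0).
Definition gV (v : 'rV[F]_n) : g := (0, v, 0).
Definition gL (S : Lambda2 F n) : g := (0, 0, S).

Lemma vb_Jordan (i : 'I_n) :
  vb F i *m D = lambda *: vb F i + \sum_(j < n | j == i.+1 :> nat) vb F j.
Proof.
apply/rowP => j; rewrite -rowE !mxE summxE eqxx andTb.
rewrite mulr_natr [j == i]eq_sym; congr (_ + _).
case: eqP => [ij|nij].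
  rewrite (bigD1 j) ?ij //= mxE !eqxx big1 ?addr0 // => k /andP[_ /negPf kj].
  by rewrite mxE [j == k]eq_sym kj.
rewrite big1 // => k /eqP ki; rewrite mxE eqxx.
by case: (eqVneq j k) => //= jk; rewrite jk ki in nij.
Qed.

Lemma lie_x_vb (i j : 'I_n) : j = i.+1 :> nat ->
  [lie gx, gV (vb F i)] = lambda *: gV (vb F i) + gV (vb F j).
Proof.
move=> ji; congr (_, _, _); rewrite /= ?scaler0 ?addr0 ?scale1r ?scale0r ?subr0 //.
  rewrite vb_Jordan (big_pred1 j) // => k.
  by rewrite -ji; apply/eqP/eqP => [/val_inj|->].
apply: val_inj; rewrite /= /der_mx /wedge_mx.
by rewrite !(mulmx0, mul0mx, trmx0, subr0, addr0, scale0r, scaler0, oppr0).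
Qed.

Lemma lie_x_vb_last (i : 'I_n) : i.+1 = n ->
  [lie gx, gV (vb F i)] = lambda *: gV (vb F i).
Proof.
move=> iN; congr (_, _, _); rewrite /= ?scaler0 ?scale1r ?scale0r ?subr0 //.
  rewrite vb_Jordan big1 ?addr0 // => k /eqP kn.
  by have := ltn_ord k; rewrite kn iN ltnn.
apply: val_inj; rewrite /= /der_mx /wedge_mx.
by rewrite !(mulmx0, mul0mx, trmx0, subr0, addr0, scale0r, scaler0, oppr0).
Qed.

Lemma lie_V_V (v w : 'rV[F]_n) : [lie gV v, gV w] = gL (wedge v w).
Proof. by congr (_, _, _); rewrite /= !scale0r subr0 ?add0r. Qed.

Lemma lie_V_Lambda2 (v : 'rV[F]_n) (S : Lambda2 F n) : [lie gV v, gL S] = 0.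
Proof.
congr (_, _, _); rewrite /= ?scale0r ?subr0 ?add0r //.
by apply: val_inj; rewrite /= /wedge_mx trmx0 mulmx0 mul0mx subr0.
Qed.

Lemma lie_Lambda2_Lambda2 (S T : Lambda2 F n) : [lie gL S, gL T] = 0.
Proof.
by congr (_, _, _); rewrite /= ?scale0r ?subr0 ?add0r ?wedge_alt.
Qed.

Lemma lie_x_Lambda2 (v w : 'rV[F]_n) :
  [lie gx, gL (wedge v w)] = gL (wedge (v *m D) w + wedge v (w *m D)).
Proof.
congr (_, _, _); rewrite /= ?mul0mx ?scale1r ?scaler0 ?subr0 ?scale0r ?subr0 //.
by rewrite wedge_alt addr0 der_wedge.
Qed.

End XFree2.

Section Rmap.
Variables (F : fieldType) (n : nat) (lambda : F) (a b c : nat).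
Variables (M : 'M[F]_(a, b)) (N : 'M[F]_(b, c)) (alpha : F).

Definition R_A : 'M[F]_(a + b + c) :=
  block_mx
    (block_mx (Jordan_block a alpha) 0 0 (Jordan_block b (alpha - lambda))) 0
    0 (Jordan_block c (alpha - 2%:R * lambda)).

Definition R_B : 'M[F]_(a + b + c) :=
  block_mx (block_mx 0 M 0 0) (col_mx 0 N) 0 0.

Definition R_v (k : nat) : 'M[F]_(a + b + c) :=
  iter k (fun X : 'M[F]_(a + b + c) => [lie R_A, X] - lambda *: X) R_B.

Definition R_V (v : 'rV[F]_n) : 'M[F]_(a + b + c) :=
  \sum_(k < n) v 0 k *: R_v k.

Definition R_Lambda2 (S : Lambda2 F n) : 'M[F]_(a + b + c) :=
  \sum_(i < n) \sum_(j < n | (i < j)%N) vsval S i j *: [lie R_v i, R_v j].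

Definition Rmap (u : xfree2 n lambda) : 'M[F]_(a + b + c) :=
  crd_x u *: R_A + R_V (crd_V u) + R_Lambda2 (crd_L u).

Fact Rmap_linear : linear Rmap.
Proof.
move=> k [[s v] S] [[t w] T]; rewrite /Rmap /= /R_V /R_Lambda2.
have -> : \sum_(i < n) (k *: v + w) 0 i *: R_v i
    = k *: \sum_(i < n) v 0 i *: R_v i + \sum_(i < n) w 0 i *: R_v i.
  rewrite scaler_sumr -big_split; apply: eq_bigr => i _.
  by rewrite !mxE scalerDl scalerA.
have -> : \sum_(i < n) \sum_(j < n | (i < j)%N)
      (k *: vsval S + vsval T) i j *: [lie R_v i, R_v j]
    = k *: (\sum_(i < n) \sum_(j < n | (i < j)%N)
              vsval S i j *: [lie R_v i, R_v j])
      + \sum_(i < n) \sum_(j < n | (i < j)%N)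
          vsval T i j *: [lie R_v i, R_v j].
  rewrite scaler_sumr -big_split; apply: eq_bigr => i _ /=.
  rewrite scaler_sumr -big_split; apply: eq_bigr => j _ /=.
  by rewrite !mxE scalerDl scalerA.
by rewrite scalerDl -scalerA !scalerDr !addrA; apply/matrixP => i j; rewrite !mxE; ring.
Qed.

Lemma R_V_vb (k : 'I_n) : R_V (vb F k) = R_v k.
Proof.
rewrite /R_V (bigD1 k) //= mxE !eqxx scale1r big1 ?addr0 // => i /negPf ik.
by rewrite mxE ik andbF scale0r.
Qed.

Lemma Rmap_x : Rmap (gx n lambda) = R_A.
Proof.
rewrite /Rmap /= scale1r /R_V big1 ?addr0 => [|i _]; last first.
  by rewrite mxE scale0r.
rewrite /R_Lambda2 big1 ?addr0 // => i _; rewrite big1 // => j _.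
by rewrite mxE scale0r.
Qed.

Lemma Rmap_V v : Rmap (gV lambda v) = R_V v.
Proof.
rewrite /Rmap /= scale0r add0r /R_Lambda2 big1 ?addr0 // => i _.
by rewrite big1 // => j _; rewrite mxE scale0r.
Qed.

Lemma Rmap_vb (k : 'I_n) : Rmap (gV lambda (vb F k)) = R_v k.
Proof. by rewrite Rmap_V R_V_vb. Qed.

Lemma Rmap_wedge v w : 2%:R != 0 :> F ->
  Rmap (gL lambda (wedge v w)) = [lie Rmap (gV lambda v), Rmap (gV lambda w)].
Proof.
move=> nz2; rewrite !Rmap_V /Rmap /= scale0r add0r.
have RVl : linear R_V.
  move=> k z z'; rewrite /R_V scaler_sumr -big_split; apply: eq_bigr => i _.
  by rewrite !mxE scalerDl scalerA.
have -> : R_V 0 = 0 by rewrite /R_V big1 // => i _; rewrite mxE scale0r.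
have := @Lambda2_universal F n _ (fun z z' => [lie R_V z, R_V z']) nz2.
case=> [z' k z1 z2|z k z1 z2|z|_ <- _]; rewrite ?RVl.
- exact: (lie_linearl (R_V z')).
- exact: (lie_linearr (R_V z)).
- exact: lie_alt.
rewrite add0r; apply: eq_bigr => i _; apply: eq_bigr => j _.
by rewrite !R_V_vb.
Qed.

End Rmap.

Definition first_ord (p : nat) (hp : (0 < p)%N) : 'I_p := Ordinal hp.
Definition last_ord (p : nat) (hp : (0 < p)%N) : 'I_p := rev_ord (Ordinal hp).

(* Main.v *)
(* Every operator Rmap u is upper triangular, so the coordinate flag consists of
   submodules; conversely it contains every submodule U.  Indeed U is stable
   under A = Rmap x and B = Rmap v_0, hence under B and under the strictly upper
   triangular matrix A - alpha (if lambda = 0) or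
   (A - alpha) (A - alpha + lambda) (A - alpha + 2 lambda) (if lambda != 0).  The
   latter has nonzero superdiagonal entries inside the three diagonal blocks, and
   B has the entries M_{a,1} and N_{b,1} at the two block corners.  So a vector of
   U whose last nonzero coordinate is the k-th one is sent by one of these
   operators to a vector of U whose last nonzero coordinate is the (k-1)-th one,
   and U contains the whole k-th term of the flag.
   The relations of the Lie algebra hold because R is graded by the blocks and
   because ad A - lambda acts on the off-diagonal blocks as ad of nilpotent Jordan
   blocks, whose n-th power vanishes as a + b, b + c <= n + 1. *)
From HB Require Import structures.
Require Import Defs.
From mathcomp Require Import all_boot all_order all_algebra.
From mathcomp Require Import ring zify.

Set Implicit Arguments.
Unset Strict Implicit.
Unset Printing Implicit Defensive.

Import GRing.Theory.
Local Open Scope ring_scope.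

(** * Filtration of matrices by a weight on the indices *)

Section Raising.
Variables (F : fieldType) (d : nat) (w : 'I_d -> nat).
Implicit Types X Y : 'M[F]_d.

(** Two weights are used: with the index itself, [s = 0] and [s = 1] mean upper and strictly upper
    triangular; with the block number, [s] measures the grading by blocks. *)
Definition raises (s : nat) X : Prop :=
  forall i j : 'I_d, (w j < w i + s)%N -> X i j = 0.

Lemma raises0 s : raises s 0.
Proof. by move=> i j _; rewrite mxE. Qed.

Lemma raisesD s X Y : raises s X -> raises s Y -> raises s (X + Y).
Proof. by move=> hX hY i j ij; rewrite mxE hX // hY // addr0. Qed.

Lemma raisesZ s k X : raises s X -> raises s (k *: X).
Proof. by move=> hX i j ij; rewrite mxE hX // mulr0. Qed.

Lemma raisesB s X Y : raises s X -> raises s Y -> raises s (X - Y).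
Proof. by move=> hX hY; rewrite -scaleN1r; apply/raisesD/raisesZ. Qed.

Lemma raises_sum s (I : Type) (r : seq I) (P : pred I) (E : I -> 'M[F]_d) :
  (forall i, P i -> raises s (E i)) -> raises s (\sum_(i <- r | P i) E i).
Proof.
by move=> hE; elim/big_ind: _ => //; [exact: raises0|exact: raisesD].
Qed.

Lemma raises_scalar k : raises 0 k%:M.
Proof.
move=> i j; rewrite addn0 mxE; case: eqVneq => [->|_]; first by rewrite ltnn.
by rewrite mulr0n.
Qed.

Lemma raises_mul s t X Y :
  raises s X -> raises t Y -> raises (s + t) (X *m Y).
Proof.
move=> hX hY i j ij; rewrite mxE big1 // => k _.
have [ki|ik] := ltnP (w k) (w i + s); first by rewrite hX // mul0r.
by rewrite hY ?mulr0 //; lia.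
Qed.

Lemma raises_lie s t X Y : raises s X -> raises t Y -> raises (s + t) [lie X, Y].
Proof.
move=> hX hY; apply: raisesB; first exact: raises_mul.
by rewrite addnC; apply: raises_mul.
Qed.

Lemma raisesW s t X : (t <= s)%N -> raises s X -> raises t X.
Proof. by move=> ts hX i j ij; apply: hX; lia. Qed.

Lemma raises_eq0 s X : (forall i j, (w j < w i + s)%N) -> raises s X -> X = 0.
Proof. by move=> hw hX; apply/matrixP => i j; rewrite hX // mxE. Qed.

End Raising.

(** * Diagonal and superdiagonal of products of upper triangular matrices *)

Section UpperTriangular.
Variables (F : fieldType) (d : nat).

Lemma raises0_mul_diag (X Y : 'M[F]_d) (i : 'I_d) :
  raises (@nat_of_ord d) 0 X -> raises (@nat_of_ord d) 0 Y ->
  (X *m Y) i i = X i i * Y i i.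
Proof.
move=> hX hY; rewrite mxE (bigD1 i) //= big1 ?addr0 // => k; rewrite -val_eqE /= => ki.
have [lt_ki|le_ik] := ltnP k i; first by rewrite hX ?mul0r ?addn0.
by rewrite [Y k i]hY ?mulr0 //; lia.
Qed.

Lemma raises0_mul_superdiag (X Y : 'M[F]_d) (i j : 'I_d) : j = i.+1 :> nat ->
  raises (@nat_of_ord d) 0 X -> raises (@nat_of_ord d) 0 Y ->
  (X *m Y) i j = X i i * Y i j + X i j * Y j j.
Proof.
move=> ji hX hY; rewrite mxE (bigD1 i) //= (bigD1 j) /=; last first.
  by rewrite -val_eqE /=; lia.
rewrite big1 ?addr0 // => k; rewrite -!val_eqE /= => kij.
have [lt_ki|le_ik] := ltnP k i; first by rewrite hX ?mul0r ?addn0.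
by rewrite [Y k j]hY ?mulr0 //; lia.
Qed.

Lemma raises0_diag0 (X : 'M[F]_d) : raises (@nat_of_ord d) 0 X ->
  (forall i, X i i = 0) -> raises (@nat_of_ord d) 1 X.
Proof.
move=> hX X0 i j ji; have [->|ne] := eqVneq i j; first exact: X0.
by apply: hX; move: ne; rewrite -val_eqE /=; lia.
Qed.

End UpperTriangular.

(** * The coordinate flag and the subspaces stable under descent *)

Section Flag.
Variables (F : fieldType) (d : nat).
Implicit Types (k l : nat) (z : 'cV[F]_d) (U : {vspace 'cV[F]_d}).

(** Presenting the flag terms as kernels of these projections makes them vector spaces by
    construction. *)
Definition tail_proj k : 'M[F]_d := \matrix_(i, j) ((i == j) && (k <= i)%N)%:R.

Definition flag k : {vspace 'cV[F]_d} := lker (linfun (mulmx (tail_proj k))).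

Lemma flagP k z :
  reflect (forall i : 'I_d, (k <= i)%N -> z i 0 = 0) (z \in flag k).
Proof.
have E i : (tail_proj k *m z) i 0 = if (k <= i)%N then z i 0 else 0.
  rewrite mxE (bigD1 i) //= mxE eqxx big1 => [|j /negPf ji]; last first.
    by rewrite mxE eq_sym ji mul0r.
  by rewrite addr0; case: ifP => _; rewrite ?mul1r ?mul0r.
rewrite memv_ker lfunE /=; apply: (iffP eqP) => [z0 i ki|hz].
  by have := E i; rewrite z0 ki mxE.
by apply/colP => i; rewrite E mxE; case: ifP => // /hz.
Qed.

Lemma flag0 : flag 0 = 0%VS.
Proof.
apply/eqP; rewrite -subv0; apply/subvP => z /flagP hz; rewrite memv0.
by apply/eqP/colP => i; rewrite hz // mxE.
Qed.

Lemma flag_full : flag d = fullv.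
Proof.
apply/eqP; rewrite eqEsubv subvf /=.
by apply/subvP => z _; apply/flagP => i; rewrite leqNgt ltn_ord.
Qed.

Lemma flag_le k l : (k <= l)%N -> (flag k <= flag l)%VS.
Proof.
move=> kl; apply/subvP => z /flagP hz; apply/flagP => i li.
by apply: hz; lia.
Qed.

(** If [l < k], the unit vector at index [l] lies in [flag k] but not in [flag l]. The bound on [k]
    matters: beyond [d] the flag is constant. *)
Lemma flag_leE k l : (k <= d)%N -> (flag k <= flag l)%VS -> (k <= l)%N.
Proof.
move=> kd /subvP kl; rewrite leqNgt; apply/negP => lk.
have ld : (l < d)%N by lia.
have /kl/flagP/(_ (Ordinal ld) (leqnn l)) :
    delta_mx (Ordinal ld) 0 \in flag k.
  apply/flagP => i ki; rewrite mxE; case: eqP => //= il.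
  by move: ki; rewrite il /=; lia.
by rewrite mxE !eqxx => /eqP; rewrite oner_eq0.
Qed.

Lemma flag_inj k l : (k <= d)%N -> (l <= d)%N -> flag k = flag l -> k = l.
Proof.
move=> kd ld kl; apply/eqP; rewrite eqn_leq.
by apply/andP; split; apply: flag_leE => //; rewrite kl.
Qed.

Lemma raises_flag (X : 'M[F]_d) s k z : raises (@nat_of_ord d) s X ->
  z \in flag (k + s) -> X *m z \in flag k.
Proof.
move=> hX /flagP hz; apply/flagP => i ki; rewrite mxE big1 // => j _.
have [ji|ij] := ltnP j (i + s); first by rewrite hX // mul0r.
by rewrite hz ?mulr0 //; lia.
Qed.

Definition stable (X : 'M[F]_d) U := forall z, z \in U -> X *m z \in U.

Lemma stable_mul (X Y : 'M[F]_d) U : stable X U -> stable Y U -> stable (X *m Y) U.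
Proof. by move=> hX hY z zU; rewrite -mulmxA; apply/hX/hY. Qed.

Variable U : {vspace 'cV[F]_d}.
Hypothesis descent : forall i j : 'I_d, j = i.+1 :> nat ->
  exists T : 'M[F]_d,
    [/\ stable T U, raises (@nat_of_ord d) 1 T & T i j != 0].

(** Induction on the last nonzero coordinate of [z]: a descent operator lowers it by one, so the
    previous flag term lies in [U], and [z] supplies the missing dimension. *)
Lemma flag_sub_stable (i : 'I_d) z :
  z \in U -> z \in flag i.+1 -> z i 0 != 0 -> (flag i.+1 <= U)%VS.
Proof.
case: i => k kd; elim: k kd z => [|k IHk] kd z zU zk z0.
  apply/subvP => y /flagP hy; move/flagP: zk => hz.
  suff -> : y = (y (Ordinal kd) 0 / z (Ordinal kd) 0) *: z by exact: memvZ.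
  apply/colP => i; rewrite !mxE; have [i0|i0] := posnP i.
    by rewrite (_ : i = Ordinal kd) ?divfK //; apply/val_inj.
  by rewrite (hy i) // (hz i) // mulr0.
have kd' : (k < d)%N by lia.
have [T [TU T1 Tij]] := @descent (Ordinal kd') (Ordinal kd) erefl.
(* Terms beyond [k.+1] vanish with the coordinates of [z], and terms before it vanish because [T] is
   strictly upper triangular. *)
have Tz : (T *m z) (Ordinal kd') 0 = T (Ordinal kd') (Ordinal kd) * z (Ordinal kd) 0.
  rewrite mxE (bigD1 (Ordinal kd)) //= big1 ?addr0 // => j /eqP jk.
  move/flagP: zk => hz.
  have [jk1|jk1] := leqP k.+2 j; first by rewrite hz // mulr0.
  rewrite T1 ?mul0r //= addn1.
  have : nat_of_ord j <> k.+1 by move=> e; apply/jk/val_inj.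
  by lia.
have /= sub := IHk kd' _ (TU _ zU).
have kU : (flag k.+1 <= U)%VS.
  apply: sub; first by apply: (raises_flag T1); rewrite addn1.
  by rewrite Tz mulf_neq0.
apply/subvP => y hy.
(* The multiple of [z] is chosen to cancel coordinate [k.+1] of [y], leaving a vector of
   [flag k.+1]. *)
rewrite -[y](subrK ((y (Ordinal kd) 0 / z (Ordinal kd) 0) *: z)).
apply: memvD; last exact: memvZ.
apply: (subvP kU); apply/flagP => i ki; rewrite !mxE.
have [ik|ik] := leqP k.+2 i.
  by rewrite (flagP _ _ hy i ik) (flagP _ _ zk i ik) mulr0 subrr.
have -> : i = Ordinal kd by apply/val_inj; rewrite /=; lia.
by rewrite divfK // subrr.
Qed.

(** In the smallest flag term containing [U], some vector of [U] has nonzero last coordinate, so [U]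
    fills that term. *)
Lemma stable_is_flag : exists2 k, (k <= d)%N & U = flag k.
Proof.
suff main k : (k <= d)%N -> (U <= flag k)%VS ->
    exists2 l, (l <= d)%N & U = flag l.
  by apply: (main d); rewrite ?flag_full ?subvf.
elim: k => [_|k IHk kd] Uk.
  by exists 0%N => //; apply/eqP; rewrite eqEsubv Uk flag0 sub0v.
have [|/subvPn[z zU zk]] := boolP (U <= flag k)%VS; first by apply: IHk; lia.
exists k.+1 => //; apply/eqP; rewrite eqEsubv Uk /=.
have zk1 := subvP Uk _ zU.
apply: (@flag_sub_stable (Ordinal kd) z) => //=.
apply: contra zk => /eqP z0; apply/flagP => i.
rewrite leq_eqVlt => /orP[/eqP ki|]; last by move/flagP: zk1; apply.
by rewrite -z0; congr (z _ _); apply/val_inj.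
Qed.

End Flag.

(** * Uniqueness of the composition series when the submodules are the flag terms *)

Section FlagSeries.
Variables (F : fieldType) (L : lieAlgType F) (d : nat) (rho : L -> 'M[F]_d).
Hypothesis rho_flag : forall k, is_submodule rho (flag F d k).
Hypothesis sub_flag : forall U, is_submodule rho U ->
  exists2 k, (k <= d)%N & U = flag F d k.

Lemma flag_composition_series :
  composition_series rho (mkseq (flag F d) d.+1).
Proof.
have nthE i : (i < d.+1)%N -> nth 0%VS (mkseq (flag F d) d.+1) i = flag F d i.
  exact: nth_mkseq.
split; rewrite ?size_mkseq ?nthE ?flag0 ?flag_full // => i id1; rewrite !nthE //; last lia.
split; first exact: flag_le.
- by apply/eqP => /flag_inj; lia.
- move=> U /sub_flag[k kd ->] ik ki.
  have {}ik : (i <= k)%N by apply: (flag_leE _ ik); lia.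
  have {}ki := flag_leE kd ki.
  have [->|->] : k = i \/ k = i.+1 by lia.
    by left.
  by right.
Qed.

Lemma composition_series_flag s :
  composition_series rho s -> s = mkseq (flag F d) d.+1.
Proof.
case=> s0 sbot stop ssub sirr.
have sE i : (i < size s)%N -> (i <= d)%N /\ nth 0%VS s i = flag F d i.
  elim: i => [_|i IHi si]; first by rewrite sbot flag0.
  have [id Ei] := IHi (ltnW si).
  have [le_s ne_s irr] := sirr i si.
  have [k kd Ek] := sub_flag (ssub _ si).
  rewrite Ei Ek in le_s ne_s irr *.
  have ik := flag_leE id le_s.
  have {}ik : (i < k)%N.
    by rewrite ltn_neqAle ik andbT; apply: contraNneq ne_s => ->.
  split; first lia.
  have id1 : (i.+1 <= d)%N by lia.
  (* The submodule [flag i.+1] lies between the consecutive terms [flag i] and [flag k];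
     irreducibility forces it to be the upper one. *)
  have [|Ei1|-> //] := irr _ (@rho_flag i.+1) (flag_le F d (leqnSn i)).
    exact: flag_le.
  by have := flag_inj id1 id Ei1; lia.
(* The last term is both the whole space and the flag term of index [(size s).-1], which fixes the
   length. *)
have ss : size s = d.+1.
  have sl : ((size s).-1 < size s)%N by lia.
  have [ld El] := sE _ sl.
  have := @flag_inj F d _ _ ld (leqnn d); rewrite -El stop flag_full => /(_ erefl).
  by lia.
apply: (@eq_from_nth _ 0%VS); first by rewrite size_mkseq.
by move=> i si; rewrite nth_mkseq -?ss //; case: (sE _ si).
Qed.

Lemma flag_unique_composition_series : exists! s, composition_series rho s.
Proof.
exists (mkseq (flag F d) d.+1); split; first exact: flag_composition_series.
by move=> s /composition_series_flag.
Qed.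

End FlagSeries.

(** * Linearity of the bracket, and linear maps on the exterior square *)

Section LieLinear.
Variables (F : fieldType) (L : lieAlgType F).

HB.instance Definition _ (u : L) :=
  GRing.isLinear.Build F L L *:%R (lie u) (lie_linearr u).

End LieLinear.

(** When 2 is invertible, the wedges of basis vectors span the space of skew-symmetric matrices. *)
Lemma eq_linear_wedge (F : fieldType) n (U : lmodType F)
    (f g : {linear Lambda2 F n -> U}) : 2%:R != 0 :> F ->
  (forall v w, f (wedge v w) = g (wedge v w)) -> f =1 g.
Proof.
move=> nz2 fg S; rewrite (Lambda2_decomp S nz2) !linear_sum.
apply: eq_bigr => i _; rewrite !linear_sum; apply: eq_bigr => j _.
by rewrite !linearZ fg.
Qed.

(** * Entries of the operators of R and their grading by the three blocks *)

Section RmapTheory.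
Variables (F : fieldType) (n : nat) (lambda : F) (a b c : nat).
Variables (M : 'M[F]_(a, b)) (N : 'M[F]_(b, c)) (alpha : F).

Local Notation A := (R_A lambda a b c alpha).
Local Notation B := (R_B M N).
Local Notation Rv := (R_v lambda M N alpha).
Local Notation RV := (@R_V F n lambda a b c M N alpha).
Local Notation RL := (@R_Lambda2 F n lambda a b c M N alpha).
Local Notation R := (@Rmap F n lambda a b c M N alpha).

(** Counting the block boundaries at or before [i] numbers the blocks 0, 1, 2. For this weight [A],
    the images of V and those of its exterior square raise by 0, 1 and 2. *)
Definition block_index (i : nat) : nat := (a <= i)%N + (a + b <= i)%N.

Lemma R_AE (i j : 'I_(a + b + c)) :
  A i j = (alpha - (block_index i)%:R * lambda) *+ (i == j)
    + ((i.+1 == j)%N && (block_index i == block_index j))%:R.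
Proof.
have index0 (k : 'I_a) : block_index k = 0%N.
  by have := ltn_ord k; rewrite /block_index; lia.
have index1 (k : 'I_b) : block_index (a + k) = 1%N.
  by have := ltn_ord k; rewrite /block_index; lia.
have index2 (k : 'I_c) : block_index (a + b + k) = 2%N.
  by rewrite /block_index; lia.
rewrite -val_eqE /=.
case: (split_ordP i) => [i' ->|i3 ->]; [case: (split_ordP i') => [i1 ->|i2 ->]|];
case: (split_ordP j) => [j' ->|j3 ->]; try case: (split_ordP j') => [j1 ->|j2 ->];
  rewrite /R_A ?(block_mxEul, block_mxEur, block_mxEdl, block_mxEdr) ?mxE -?val_eqE /=
    !(index0, index1, index2) -?addnS ?eqn_add2l ?andbT ?andbF ?mul0r ?mul1r ?subr0 ?addr0 //.
(* Indices taken from different blocks are never equal. *)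
all: match goal with |- 0 = _ *+ nat_of_bool ?e => have -> // : e = false end.
all: try have hi1 := ltn_ord i1; try have hi2 := ltn_ord i2;
     try have hj1 := ltn_ord j1; try have hj2 := ltn_ord j2.
all: lia.
Qed.

Lemma block_index_mono i j : (i <= j)%N -> (block_index i <= block_index j)%N.
Proof. by rewrite /block_index; lia. Qed.

Lemma R_A_raises_ord : raises (@nat_of_ord (a + b + c)) 0 A.
Proof.
move=> i j ji; rewrite R_AE -val_eqE /=.
have -> : (i == j :> nat) = false by lia.
have -> : (i.+1 == j)%N = false by lia.
exact: addr0.
Qed.

Lemma R_A_raises_block : raises (fun i : 'I_(a + b + c) => block_index i) 0 A.
Proof.
move=> i j ji; rewrite R_AE.
have -> : (i == j) = false by apply: contraTF ji => /eqP ->; rewrite addn0 ltnn.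
have -> : (block_index i == block_index j) = false by lia.
by rewrite andbF addr0.
Qed.

Lemma R_B_block_index (i j : 'I_(a + b + c)) : B i j != 0 -> block_index j = (block_index i).+1.
Proof.
apply: contraNeq; rewrite /block_index.
case: (split_ordP i) => [i' ->|i3 ->]; [case: (split_ordP i') => [i1 ->|i2 ->]|];
case: (split_ordP j) => [j' ->|j3 ->]; try case: (split_ordP j') => [j1 ->|j2 ->];
  rewrite /R_B ?(block_mxEul, block_mxEur, block_mxEdl, block_mxEdr, col_mxEu, col_mxEd) ?mxE //=.
all: try have hi1 := ltn_ord i1; try have hi2 := ltn_ord i2;
     try have hj1 := ltn_ord j1; try have hj2 := ltn_ord j2.
all: by move=> h; exfalso; move: h; lia.
Qed.

Lemma R_B_raises_block : raises (fun i : 'I_(a + b + c) => block_index i) 1 B.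
Proof.
move=> i j ji; apply/eqP; apply: contraTT isT => /R_B_block_index e.
by move: ji; rewrite e; lia.
Qed.

(** Block numbers are monotone in the index, so entering a later block means lying strictly right of
    the diagonal. *)
Lemma R_B_raises_ord : raises (@nat_of_ord (a + b + c)) 1 B.
Proof.
move=> i j ji; apply/eqP; apply: contraTT isT => /R_B_block_index e.
by have := @block_index_mono j i; rewrite e; lia.
Qed.


Lemma R_vS k : Rv k.+1 = [lie A, Rv k] - lambda *: Rv k.
Proof. by []. Qed.

Lemma R_v_raises_block k : raises (fun i : 'I_(a + b + c) => block_index i) 1 (Rv k).
Proof.
elim: k => [|k IHk]; first exact: R_B_raises_block.
rewrite R_vS; apply: raisesB; last exact: raisesZ.
exact: (raises_lie R_A_raises_block IHk).
Qed.

Lemma R_v_raises_ord k : raises (@nat_of_ord (a + b + c)) 0 (Rv k).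
Proof.
elim: k => [|k IHk]; first exact: (raisesW _ R_B_raises_ord).
rewrite R_vS; apply: raisesB; last exact: raisesZ.
exact: (raises_lie R_A_raises_ord IHk).
Qed.

Lemma R_V_raises_block v : raises (fun i : 'I_(a + b + c) => block_index i) 1 (RV v).
Proof. by apply: raises_sum => k _; apply/raisesZ/R_v_raises_block. Qed.

Lemma R_Lambda2_raises_block S :
  raises (fun i : 'I_(a + b + c) => block_index i) 2 (RL S).
Proof.
apply: raises_sum => i _; apply: raises_sum => j _; apply: raisesZ.
exact: (raises_lie (R_v_raises_block i) (R_v_raises_block j)).
Qed.

Lemma Rmap_raises_ord u : raises (@nat_of_ord (a + b + c)) 0 (R u).
Proof.
apply: raisesD; first apply: raisesD.
- exact/raisesZ/R_A_raises_ord.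
- by apply: raises_sum => k _; apply/raisesZ/R_v_raises_ord.
- apply: raises_sum => i _; apply: raises_sum => j _; apply: raisesZ.
  exact: (raises_lie (R_v_raises_ord i) (R_v_raises_ord j)).
Qed.

(** There are only three blocks, so no entry can climb three of them. This kills the brackets that
    vanish in a 2-step nilpotent algebra. *)
Lemma block_raises3_eq0 (X : 'M[F]_(a + b + c)) :
  raises (fun i : 'I_(a + b + c) => block_index i) 3 X -> X = 0.
Proof. by apply: raises_eq0 => i j; rewrite /block_index; lia. Qed.

Lemma R_V_Lambda2_commute v S : [lie RV v, RL S] = 0.
Proof.
apply: block_raises3_eq0.
exact: (raises_lie (R_V_raises_block v) (R_Lambda2_raises_block S)).
Qed.

Lemma R_Lambda2_commute S T : [lie RL S, RL T] = 0.
Proof.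
apply: block_raises3_eq0; apply: (@raisesW _ _ _ (2 + 2)) => //.
exact: (raises_lie (R_Lambda2_raises_block S) (R_Lambda2_raises_block T)).
Qed.

(** * The operator ad A - lambda on the off-diagonal blocks *)

Lemma Jordan_blockE p (beta : F) : Jordan_block p beta = beta%:M + Jordan_block p 0.
Proof. by apply/matrixP => i j; rewrite !mxE mul0rn add0r. Qed.

Definition Jordan_ad p q (X : 'M[F]_(p, q)) : 'M[F]_(p, q) :=
  Jordan_block p 0 *m X - X *m Jordan_block q 0.

(** The conditional sum has at most one term; it is empty, hence 0, for the last row, where index
    [i.+1] does not exist. *)
Lemma Jordan_mull p q (X : 'M[F]_(p, q)) i j :
  (Jordan_block p 0 *m X) i j = \sum_(k < p | i.+1 == k :> nat) X k j.
Proof.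
rewrite mxE [RHS]big_mkcond; apply: eq_bigr => k _; rewrite mxE mul0rn add0r.
by case: eqP => _; rewrite ?mul1r ?mul0r.
Qed.

Lemma Jordan_mulr p q (X : 'M[F]_(p, q)) i j :
  (X *m Jordan_block q 0) i j = \sum_(k < q | k.+1 == j :> nat) X i k.
Proof.
rewrite mxE [RHS]big_mkcond; apply: eq_bigr => k _; rewrite mxE mul0rn add0r.
by case: eqP => _; rewrite ?mulr1 ?mulr0.
Qed.

(* Each application pushes the support one diagonal up, and a p x q matrix has
   p + q - 1 diagonals. *)
Lemma iter_Jordan_ad_support p q (X : 'M[F]_(p, q)) k
    (i : 'I_p) (j : 'I_q) :
  (j + p < i + k + 1)%N -> iter k (@Jordan_ad p q) X i j = 0.
Proof.
elim: k i j => [|k IHk] i j ij; first by have := ltn_ord i; lia.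
rewrite /= /Jordan_ad mxE [X in _ + X]mxE Jordan_mull Jordan_mulr.
by rewrite !big1 ?subr0 // => l /eqP el; apply: IHk; lia.
Qed.

Lemma iter_Jordan_ad_eq0 p q (X : 'M[F]_(p, q)) k :
  (p + q <= k + 1)%N -> iter k (@Jordan_ad p q) X = 0.
Proof.
move=> pqk; apply/matrixP => i j; rewrite iter_Jordan_ad_support ?mxE //.
by have := ltn_ord j; lia.
Qed.

Lemma R_B_linear2 (X1 X2 X3 : 'M[F]_(a, b)) (Y1 Y2 Y3 : 'M[F]_(b, c)) k :
  R_B X1 Y1 - R_B X2 Y2 - k *: R_B X3 Y3
    = R_B (X1 - X2 - k *: X3) (Y1 - Y2 - k *: Y3).
Proof.
apply/matrixP => i j; rewrite /R_B.
case: (split_ordP i) => [i' ->|i3 ->]; [case: (split_ordP i') => [i1 ->|i2 ->]|];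
case: (split_ordP j) => [j' ->|j3 ->]; try case: (split_ordP j') => [j1 ->|j2 ->];
  rewrite !(block_mxEul, block_mxEur, block_mxEdl, block_mxEdr, col_mxEu, col_mxEd, mxE).
all: by rewrite ?mulr0 ?subr0.
Qed.

(** The eigenvalue drops by [lambda] from each block to the next, so subtracting [lambda] cancels
    the scalar parts and leaves only nilpotent Jordan blocks. *)
Lemma lie_A_block (X : 'M[F]_(a, b)) (Y : 'M[F]_(b, c)) :
  [lie A, R_B X Y] - lambda *: R_B X Y = R_B (Jordan_ad X) (Jordan_ad Y).
Proof.
have shift p q beta (Z : 'M[F]_(p, q)) :
    Jordan_block p (beta + lambda) *m Z - Z *m Jordan_block q beta - lambda *: Z
      = Jordan_ad Z.
  rewrite Jordan_blockE [Jordan_block q beta]Jordan_blockE /Jordan_ad.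
  rewrite mulmxDl mulmxDr mul_scalar_mx mul_mx_scalar.
  by apply/matrixP => i j; rewrite !mxE; ring.
have AB : A *m R_B X Y =
    R_B (Jordan_block a alpha *m X) (Jordan_block b (alpha - lambda) *m Y).
  rewrite /R_A /R_B mulmx_block mulmx_block mul_block_col.
  by rewrite !(mul0mx, mulmx0, addr0, add0r).
have BA : R_B X Y *m A =
    R_B (X *m Jordan_block b (alpha - lambda)) (Y *m Jordan_block c (alpha - 2%:R * lambda)).
  rewrite /R_A /R_B mulmx_block mulmx_block.
  rewrite !(mul0mx, mulmx0, addr0, add0r).
  by rewrite mul_col_mx mul0mx.
have -> : [lie A, R_B X Y] = A *m R_B X Y - R_B X Y *m A by [].
rewrite AB BA -(shift _ _ (alpha - lambda) X) -(shift _ _ (alpha - 2%:R * lambda) Y).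
have -> : alpha - 2%:R * lambda + lambda = alpha - lambda by ring.
by rewrite subrK -R_B_linear2.
Qed.

Lemma R_vE k : Rv k = R_B (iter k (@Jordan_ad a b) M) (iter k (@Jordan_ad b c) N).
Proof. by elim: k => [//|k IHk]; rewrite R_vS IHk lie_A_block. Qed.

Lemma R_v_eq0 k : (a + b <= k + 1)%N -> (b + c <= k + 1)%N -> Rv k = 0.
Proof.
move=> abk bck; rewrite R_vE !iter_Jordan_ad_eq0 //.
by rewrite /R_B col_mx0 !block_mx0.
Qed.

Lemma R_V_is_linear : linear RV.
Proof.
move=> k v w; rewrite /R_V scaler_sumr -big_split; apply: eq_bigr => i _.
by rewrite !mxE scalerDl scalerA.
Qed.

HB.instance Definition _ :=
  GRing.isLinear.Build F 'rV[F]_n 'M[F]_(a + b + c) *:%R RV R_V_is_linear.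

Lemma R_Lambda2_is_linear : linear RL.
Proof.
move=> k S T; rewrite /R_Lambda2 scaler_sumr -big_split; apply: eq_bigr => i _.
rewrite scaler_sumr -big_split; apply: eq_bigr => j _ /=.
by rewrite !mxE scalerDl scalerA.
Qed.

HB.instance Definition _ :=
  GRing.isLinear.Build F (Lambda2 F n) 'M[F]_(a + b + c) *:%R RL R_Lambda2_is_linear.

(** * Strictly upper triangular polynomials in A *)

Definition A_shift (k : nat) : 'M[F]_(a + b + c) := A - (alpha - k%:R * lambda)%:M.

Lemma A_shift_raises k : raises (@nat_of_ord (a + b + c)) 0 (A_shift k).
Proof. by apply: raisesB; [exact: R_A_raises_ord|exact: raises_scalar]. Qed.

Lemma A_shiftE k i j :
  A_shift k i j = ((k%:R - (block_index i)%:R) * lambda) *+ (i == j)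
    + ((i.+1 == j)%N && (block_index i == block_index j))%:R.
Proof.
have -> : A_shift k i j = A i j - (alpha - k%:R * lambda)%:M i j.
  by rewrite mxE; congr (_ + _); rewrite mxE.
by rewrite R_AE mxE addrAC -mulrnBl; congr (_ *+ _ + _); ring.
Qed.

Lemma A_shift_diag k i : A_shift k i i = (k%:R - (block_index i)%:R) * lambda.
Proof.
rewrite A_shiftE eqxx; have -> : (i.+1 == i)%N = false by lia.
by rewrite addr0.
Qed.

Lemma A_shift_superdiag k (i j : 'I_(a + b + c)) : j = i.+1 :> nat ->
  block_index i = block_index j -> A_shift k i j = 1.
Proof.
move=> ji bij; rewrite A_shiftE bij -val_eqE /= ji !eqxx.
have -> : (i == i.+1 :> nat) = false by lia.
by rewrite mulr0n add0r.
Qed.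

Definition A_nilpart : 'M[F]_(a + b + c) := A_shift 0 *m A_shift 1 *m A_shift 2.

(** As [alpha - k%:R * lambda] is the eigenvalue on block [k], the factor [A_shift k] has zero
    diagonal there, and diagonals of upper triangular matrices multiply. *)
Lemma A_nilpart_raises : raises (@nat_of_ord (a + b + c)) 1 A_nilpart.
Proof.
have h01 := raises_mul (A_shift_raises 0) (A_shift_raises 1).
have h012 := raises_mul h01 (A_shift_raises 2).
apply: raises0_diag0 => // i.
rewrite (raises0_mul_diag _ h01 (A_shift_raises 2)).
rewrite (raises0_mul_diag _ (A_shift_raises 0) (A_shift_raises 1)) !A_shift_diag.
have : (block_index i <= 2)%N by rewrite /block_index; lia.
by case: (block_index i) => [|[|[|//]]] _; ring.
Qed.

(** Only the term taking its superdiagonal 1 from the factor with zero diagonal survives; the entry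
    is the product of the other two diagonal values. *)
Lemma A_nilpart_superdiag (i j : 'I_(a + b + c)) : j = i.+1 :> nat ->
  block_index i = block_index j ->
  2%:R != 0 :> F -> lambda != 0 -> A_nilpart i j != 0.
Proof.
move=> ji bij nz2 l0.
have h01 := raises_mul (A_shift_raises 0) (A_shift_raises 1).
rewrite /A_nilpart (raises0_mul_superdiag ji h01 (A_shift_raises 2)).
rewrite (raises0_mul_superdiag ji (A_shift_raises 0) (A_shift_raises 1)).
rewrite (raises0_mul_diag _ (A_shift_raises 0) (A_shift_raises 1)).
rewrite !A_shift_diag !(A_shift_superdiag _ ji bij) -bij.
have : (block_index i <= 2)%N by rewrite /block_index; lia.
case: (block_index i) => [|[|[|//]]] _.
- rewrite (_ : _ + _ = 2%:R * lambda ^+ 2); last by ring.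
  by rewrite mulf_neq0 ?expf_neq0.
- rewrite (_ : _ + _ = - lambda ^+ 2); last by ring.
  by rewrite oppr_eq0 expf_neq0.
- rewrite (_ : _ + _ = 2%:R * lambda ^+ 2); last by ring.
  by rewrite mulf_neq0 ?expf_neq0.
Qed.

(** * Descent operators preserving a submodule *)

Lemma R_B_corner (a_gt0 : (0 < a)%N) (b_gt0 : (0 < b)%N) (c_gt0 : (0 < c)%N)
    (i j : 'I_(a + b + c)) :
  M (last_ord a_gt0) (first_ord b_gt0) != 0 ->
  N (last_ord b_gt0) (first_ord c_gt0) != 0 ->
  j = i.+1 :> nat -> block_index i != block_index j -> B i j != 0.
Proof.
move=> hM hN; rewrite /block_index.
case: (split_ordP i) => [i' ->|i3 ->]; [case: (split_ordP i') => [i1 ->|i2 ->]|];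
case: (split_ordP j) => [j' ->|j3 ->]; try case: (split_ordP j') => [j1 ->|j2 ->];
  rewrite /R_B ?(block_mxEul, block_mxEur, block_mxEdl, block_mxEdr, col_mxEu, col_mxEd) /= => ji bij.
all: try have hi1 := ltn_ord i1; try have hi2 := ltn_ord i2;
     try have hj1 := ltn_ord j1; try have hj2 := ltn_ord j2.
(* Only the two corners remain: a superdiagonal position leaving a block goes from its last row to
   the first column of the next block. *)
all: try lia.
- have -> : i1 = last_ord a_gt0 by apply/val_inj; rewrite /=; lia.
  by have -> : j2 = first_ord b_gt0 by apply/val_inj; rewrite /=; lia.
- have -> : i2 = last_ord b_gt0 by apply/val_inj; rewrite /=; lia.
  by have -> : j3 = first_ord c_gt0 by apply/val_inj; rewrite /=; lia.
Qed.

Lemma A_shift_stable k U : stable A U -> stable (A_shift k) U.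
Proof.
by move=> hA z zU; rewrite mulmxBl mul_scalar_mx memvB ?memvZ ?hA.
Qed.

Lemma submodule_descent (n_gt0 : (0 < n)%N)
    (a_gt0 : (0 < a)%N) (b_gt0 : (0 < b)%N) (c_gt0 : (0 < c)%N) U :
  2%:R != 0 :> F ->
  M (last_ord a_gt0) (first_ord b_gt0) != 0 ->
  N (last_ord b_gt0) (first_ord c_gt0) != 0 ->
  is_submodule R U ->
  forall i j : 'I_(a + b + c), j = i.+1 :> nat ->
  exists T : 'M[F]_(a + b + c),
    [/\ stable T U, raises (@nat_of_ord (a + b + c)) 1 T & T i j != 0].
Proof.
move=> nz2 hM hN subU i j ji.
have stA : stable A U by move=> z; rewrite -(Rmap_x n _ M N); apply: subU.
have stB : stable B U.
  by move=> z; rewrite -[B]/(Rv (Ordinal n_gt0)) -Rmap_vb; apply: subU.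
have [bij|bij] := eqVneq (block_index i) (block_index j); last first.
  by exists B; split=> //; [exact: R_B_raises_ord|exact: (R_B_corner hM hN)].
(* For [lambda = 0] the three shifts coincide and [A_nilpart] is a cube with zero superdiagonal, so
   a single shift is taken instead. *)
have [l0|l0] := eqVneq lambda 0.
  exists (A_shift 0); split; first exact: A_shift_stable.
    apply: raises0_diag0 (A_shift_raises 0) _ => k.
    by rewrite A_shift_diag l0 mulr0.
  by rewrite A_shift_superdiag // oner_eq0.
exists A_nilpart; split; last exact: A_nilpart_superdiag.
  by do 2?apply: stable_mul; apply: A_shift_stable.
exact: A_nilpart_raises.
Qed.

(** * Compatibility of R with the Lie brackets *)

Hypotheses (abn : (a + b <= n + 1)%N) (bcn : (b + c <= n + 1)%N).
Hypothesis nz2 : 2%:R != 0 :> F.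

Lemma R_V_Jordan v : RV (v *m Jordan_block n lambda) = [lie A, RV v].
Proof.
rewrite [in LHS](row_sum_delta v) mulmx_suml linear_sum [RHS]linear_sum /=.
apply: eq_bigr => i _; rewrite -scalemxAl [LHS]linearZ [RHS]linearZ /=.
congr (_ *: _); rewrite vb_Jordan linearD linearZ linear_sum /= R_V_vb.
(* For the last basis vector the sum is empty, and the size bounds give [Rv n = 0]. *)
have -> : \sum_(j < n | j == i.+1 :> nat) RV (vb F j) = Rv i.+1.
  have [i1n|ni1] := ltnP i.+1 n.
    by rewrite (big_pred1 (Ordinal i1n)) ?R_V_vb // => j.
  rewrite big1 => [|j /eqP ji]; last by have := ltn_ord j; lia.
  by rewrite R_v_eq0 //; lia.
by rewrite R_vS addrC subrK.
Qed.

Lemma R_Lambda2_wedge v w : RL (wedge v w) = [lie RV v, RV w].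
Proof.
have := Rmap_wedge lambda M N alpha v w nz2; rewrite !Rmap_V => <-.
by rewrite /Rmap /= scale0r add0r linear0 add0r.
Qed.

(** Both sides are linear in [S]; on wedges the identity is the Leibniz rule for ad A on a
    commutator. *)
Lemma R_Lambda2_der S : RL (der (Jordan_block n lambda) S) = [lie A, RL S].
Proof.
apply: (eq_linear_wedge (f := RL \o der (Jordan_block n lambda))
  (g := lie A \o RL)) nz2 _ S => v w /=.
rewrite der_wedge linearD /= !R_Lambda2_wedge !R_V_Jordan.
rewrite /lie /= /commutator !(mulmxBl, mulmxBr) !mulmxA.
by apply/matrixP => k l; rewrite !mxE; ring.
Qed.

Lemma Rmap_is_representation : is_representation R.
Proof.
split; first exact: Rmap_linear.
move=> [[s v] S] [[t w] T]; rewrite {1}/lie /= /xfree2_lie /Rmap /crd_x /crd_V /crd_L /=.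
move: (s : F) (t : F) => {}s {}t.
rewrite scale0r add0r linearB linearD linearB !linearZ /=.
rewrite !R_V_Jordan !R_Lambda2_der R_Lambda2_wedge.
have hvT := R_V_Lambda2_commute v T; have hwS := R_V_Lambda2_commute w S.
have hST := R_Lambda2_commute S T.
move: hvT hwS hST; rewrite /lie /= /commutator.
(* Vanishing commutators become equalities of products, which rewrite the expanded bracket. *)
move=> /subr0_eq hvT /subr0_eq hwS /subr0_eq hST.
rewrite !(mulmxDl, mulmxDr) -!(scalemxAl, scalemxAr) hvT hwS hST.
by apply/matrixP => k l; rewrite !mxE; ring.
Qed.

End RmapTheory.

Theorem proposition3p3 (F : closedFieldType) (charF0 : [pchar F] =i pred0)
    (n : nat) (n_gt1 : (1 < n)%N) (lambda : F)
    (a b c : nat) (a_gt0 : (0 < a)%N) (b_gt0 : (0 < b)%N) (c_gt0 : (0 < c)%N)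
    (habc : (a + b = n + 1)%N /\ (c <= a)%N \/ (c + b = n + 1)%N /\ (a <= c)%N)
    (M : 'M[F]_(a, b)) (N : 'M[F]_(b, c))
    (hM : M (last_ord a_gt0) (first_ord b_gt0) != 0)
    (hN : N (last_ord b_gt0) (first_ord c_gt0) != 0)
    (alpha : F) :
  is_uniserial_representation (@Rmap F n lambda a b c M N alpha).
Proof.
(* Both the skew-matrix model of the exterior square and the superdiagonal entries [2 * lambda ^+ 2]
   rely on this. *)
have nz2 : 2%:R != 0 :> F by rewrite ((pcharf0P F).1 charF0).
(* Either alternative of [habc] bounds both [a + b] and [b + c] by [n + 1]. *)
split; first by apply: Rmap_is_representation => //; lia.
apply: flag_unique_composition_series => [k u z zk|U subU].
  by apply: raises_flag (Rmap_raises_ord _ _ _ _) _; rewrite ?addn0.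
exact/stable_is_flag/(submodule_descent (ltnW n_gt1) nz2 hM hN subU).
Qed.
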